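(* Let $\mathcal{A}$, $\mathcal{A}_1$, $\{p_\alpha\}_\alpha$, $\Phi$, $b$, $\beta$ and $T$ be as in the context (in particular $\Phi$ is strongly aperiodic with respect to $\{p_\alpha\}_\alpha$). Then the following statements are equivalent. (1) The set of $\beta$-periodic elements of $T$ is dense in $\mathcal{A}$. (2) There exists a dense set $\mathcal{D}$ in $\mathcal{A}$ such that for every $x\in\mathcal{D}$ and every index $\alpha$ there exist $\widetilde{b}\in\beta$ and $d\in\mathbb{N}$ such that the series $$\sum_{n=1}^{\infty}(\widetilde{b}T)^{ndk}(x)\,\Phi^{ndk}(p_\alpha)\quad\text{and}\quad \sum_{n=1}^{\infty}(\widetilde{b}S)^{ndk}(x)\,\Phi^{-ndk}(p_\alpha)$$ are convergent in $\mathcal{A}$ for each $k\in\mathbb{N}$, and moreover $$\lim_{k\to\infty}\sum_{n=1}^{\infty}(\widetilde{b}T)^{ndk}(x)\,\Phi^{ndk}(p_\alpha)=\lim_{k\to\infty}\sum_{n=1}^{\infty}(\widetilde{b}S)^{ndk}(x)\,\Phi^{-ndk}(p_\alpha)=0 .$$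
   Context: $\mathbb{N}=\{1,2,3,\dots\}$. Setting. $\mathcal{A}$ is a non-unital Banach algebra with norm $\|\cdot\|$ which is a left ideal in a unital Banach algebra $\mathcal{A}_1$ with norm $\|\cdot\|_1$. There is a constant $K>0$ such that $\|ca\|\le K\|c\|_1\|a\|$ for all $a\in\mathcal{A}$, $c\in\mathcal{A}_1$. (It is not assumed that $\|\cdot\|$ extends to $\|\cdot\|_1$.) $\{p_\alpha\}_\alpha$ is a family of elements of $\mathcal{A}$ such that: (i) (right-approximation property) for every non-empty open $\mathcal{O}\subseteq\mathcal{A}$ and every $u\in\mathcal{O}$ there is some $\alpha$ with $up_\alpha\in\mathcal{O}$; (ii) $\|ap_\alpha\|\le\|a\|$ for all $a\in\mathcal{A}$ and all $\alpha$. $\Phi$ is an isometric algebra isomorphism of $\mathcal{A}_1$ onto itself (for $\|\cdot\|_1$) whose restriction to $\mathcal{A}$ is an isometric isomorphism of $\mathcal{A}$ onto itself (for $\|\cdot\|$). $\Phi$ is strongly aperiodic with respect to $\{p_\alpha\}_\alpha$: for every $\alpha$ there exists $N_\alpha\in\mathbb{N}$ such that for all $a\in\mathcal{A}$ and every integer $l\ge N_\alpha$ the series $\sum_{n=1}^\infty a\Phi^{nl}(p_\alpha)$ and $\sum_{n=1}^\infty a\Phi^{-nl}(p_\alpha)$ converge in $\mathcal{A}$, and $$\lim_{k\to\infty}\sum_{n=1}^{\infty}a\Phi^{nlk}(p_\alpha)=\lim_{k\to\infty}\sum_{n=1}^{\infty}a\Phi^{-nlk}(p_\alpha)=0.$$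 Operators. $b$ is an invertible element of $\mathcal{A}_1$, and $T:\mathcal{A}\to\mathcal{A}$ is the bounded invertible linear operator $T(a)=b\,\Phi(a)$. $\beta$ is a subset of the set $G(\mathcal{A}_1)$ of invertible elements of $\mathcal{A}_1$. For $\widetilde{b}\in\beta$, $\widetilde{b}T$ is the operator on $\mathcal{A}$ given by $(\widetilde{b}T)(a)=\widetilde{b}\,T(a)=\widetilde{b}b\,\Phi(a)$, and $\widetilde{b}S$ denotes its inverse, $\widetilde{b}S:=(\widetilde{b}T)^{-1}$, so that $$(\widetilde{b}S)^n(a)=\Phi^{-1}\big((\widetilde{b}b)^{-1}\big)\cdots\Phi^{-n}\big((\widetilde{b}b)^{-1}\big)\,\Phi^{-n}(a).$$ An element $x\in\mathcal{A}$ is a $\beta$-periodic element of $T$ if there exist $\widetilde{b}\in\beta$ and $d\in\mathbb{N}$ such that $(\widetilde{b}T)^{nd}(x)=x$ for all $n\in\mathbb{N}$. *)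

(* Defs.v *)
From HB Require Import structures.
From mathcomp Require Import all_boot all_order all_algebra.
From mathcomp Require Import all_classical all_reals all_analysis.

Set Implicit Arguments.
Unset Strict Implicit.
Unset Printing Implicit Defensive.

Import Order.TTheory GRing.Theory Num.Theory.
Import numFieldNormedType.Exports.

Local Open Scope classical_set_scope.
Local Open Scope ring_scope.

(* MathComp rings all have a unit, so the product of a possibly non-unital
   Banach algebra is an operation on top of the Banach space structure.  The
   scalars are an arbitrary numFieldType, which covers the real and the complex
   field; in a K-normed module the norm takes its values in K. *)
HB.mixin Record CompleteNormedModule_isBanachAlgebra (K : numFieldType) A
    of CompleteNormedModule K A := {
  bmul : A -> A -> A ;
  bmulA : forall x y z : A, bmul x (bmul y z) = bmul (bmul x y) z ;
  bmulDl : forall x y z : A, bmul (x + y) z = bmul x z + bmul y z ;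
  bmulDr : forall x y z : A, bmul x (y + z) = bmul x y + bmul x z ;
  bmulZl : forall (k : K) (x y : A), bmul (k *: x) y = k *: bmul x y ;
  bmulZr : forall (k : K) (x y : A), bmul x (k *: y) = k *: bmul x y ;
  bmul_norm : forall x y : A, `|bmul x y| <= `|x| * `|y|
}.

#[short(type="banachAlgType")]
HB.structure Definition BanachAlgebra (K : numFieldType) :=
  {A of CompleteNormedModule_isBanachAlgebra K A & CompleteNormedModule K A}.

(* The unit is an operation too: unitAlgType cannot be joined with normed
   modules in the MathComp hierarchy.  The normalisation
   `|bone| = 1 is not imposed. *)
HB.mixin Record BanachAlgebra_hasUnit (K : numFieldType) A
    of BanachAlgebra K A := {
  bone : A ;
  bmul1l : forall x : A, bmul bone x = x ;
  bmul1r : forall x : A, bmul x bone = x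
}.

#[short(type="unitalBanachAlgType")]
HB.structure Definition UnitalBanachAlgebra (K : numFieldType) :=
  {A of BanachAlgebra_hasUnit K A & BanachAlgebra K A}.

Definition binverse (K : numFieldType) (A1 : unitalBanachAlgType K)
    (c : A1) : set A1 := [set c' | bmul c c' = bone /\ bmul c' c = bone].

(* The group G(A1) *)
Definition bunit (K : numFieldType) (A1 : unitalBanachAlgType K) : set A1 :=
  [set c | binverse c !=set0].

(* The inverse of c if c is invertible, and 0 otherwise. *)
Definition binv (K : numFieldType) (A1 : unitalBanachAlgType K) (c : A1) : A1 :=
  xget 0 (binverse c).

Definition nonunital (K : numFieldType) (A : banachAlgType K) : Prop :=
  ~ exists e : A, forall a : A, bmul e a = a /\ bmul a e = a.

(* A is a left ideal of A1: an algebra embedding whose image absorbs left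
   multiplication; [lact c a] is the product c a seen in A, which [lactE]
   determines uniquely.  Nothing relates the norms of A and A1. *)
Record leftIdeal (K : numFieldType) (A : banachAlgType K)
    (A1 : unitalBanachAlgType K) := LeftIdeal {
  lemb :> {linear A -> A1} ;
  lemb_inj : injective lemb ;
  lembM : forall a a' : A, lemb (bmul a a') = bmul (lemb a) (lemb a') ;
  lact : A1 -> A -> A ;
  lactE : forall (c : A1) (a : A), lemb (lact c a) = bmul c (lemb a)
}.

(* An isometric automorphism of A1 restricting to an isometric bijection of A;
   the restriction and its inverse are carried as maps of A.  Preservation
   of the unit by [aut1] follows from surjectivity; linearity and
   multiplicativity of [aut] follow from [autE]. *)
Record idealAut (K : numFieldType) (A : banachAlgType K)
    (A1 : unitalBanachAlgType K) (J : leftIdeal A A1) := IdealAut {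
  aut1 : {linear A1 -> A1} ;
  aut1M : forall c c' : A1, aut1 (bmul c c') = bmul (aut1 c) (aut1 c') ;
  aut1_bij : bijective aut1 ;
  aut1_norm : forall c : A1, `|aut1 c| = `|c| ;
  aut : A -> A ;
  autV : A -> A ;
  autK : cancel aut autV ;
  autVK : cancel autV aut ;
  autE : forall a : A, J (aut a) = aut1 (J a) ;
  aut_norm : forall a : A, `|aut a| = `|a|
}.

(* The series f 1 + f 2 + ... *)
Definition series1 (K : numFieldType) (A : completeNormedModType K)
    (f : nat -> A) : nat -> A :=
  fun N => \sum_(1 <= n < N.+1) f n.

Definition series1_cvg (K : numFieldType) (A : completeNormedModType K)
    (f : nat -> A) : Prop := cvgn (series1 f).

(* Meaningful only under [series1_cvg f]. *)
Definition series1_sum (K : numFieldType) (A : completeNormedModType K)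
    (f : nat -> A) : A := limn (series1 f).

Definition right_approximation (K : numFieldType) (A : banachAlgType K)
    (I : Type) (p : I -> A) : Prop :=
  forall O : set A, O !=set0 -> open O ->
  forall u : A, O u -> exists i : I, O (bmul u (p i)).

Section Operators.
Context {K : numFieldType} {A : banachAlgType K} {A1 : unitalBanachAlgType K}.
Context {J : leftIdeal A A1} (Phi : idealAut J).

Definition strongly_aperiodic (I : Type) (p : I -> A) : Prop :=
  forall i : I, exists2 N : nat, (0 < N)%N &
  forall (a : A) (l : nat), (N <= l)%N ->
    [/\ series1_cvg (fun n => bmul a (iter (n * l) (aut Phi) (p i))),
        series1_cvg (fun n => bmul a (iter (n * l) (autV Phi) (p i))),
        series1_sum (fun n => bmul a (iter (n * l * k) (aut Phi) (p i)))
          @[k --> \oo] --> (0 : A)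
      & series1_sum (fun n => bmul a (iter (n * l * k) (autV Phi) (p i)))
          @[k --> \oo] --> (0 : A)].

Definition opT (b : A1) (a : A) : A := lact J b (aut Phi a).

(* The operator bt T *)
Definition wopT (b bt : A1) (a : A) : A := lact J bt (opT b a).

(* The operator bt S, inverse of bt T when bt and b are invertible: see
   [wopTK] and [wopSK]. *)
Definition wopS (b bt : A1) (a : A) : A := autV Phi (lact J (binv (bmul bt b)) a).

Definition weighted_periodic (b : A1) (beta : set A1) : set A :=
  [set x | exists2 bt : A1, beta bt & exists2 d : nat, (0 < d)%N &
     forall n : nat, (0 < n)%N -> iter (n * d) (wopT b bt) x = x].

Lemma lactM (c c' : A1) (a : A) :
  lact J c (lact J c' a) = lact J (bmul c c') a.
Proof. by apply: (@lemb_inj _ _ _ J); rewrite !lactE bmulA. Qed.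

Lemma lact1 (a : A) : lact J bone a = a.
Proof. by apply: (@lemb_inj _ _ _ J); rewrite lactE bmul1l. Qed.

Lemma binvP (c : A1) : bunit c -> binverse c (binv c).
Proof. by move=> [c' hc']; rewrite /binv; apply: xgetI hc'. Qed.

Lemma bunitM (c c' : A1) : bunit c -> bunit c' -> bunit (bmul c c').
Proof.
move=> [d [cd dc]] [d' [cd' dc']]; exists (bmul d' d); split.
  by rewrite bmulA -(bmulA c) cd' bmul1r.
by rewrite bmulA -(bmulA d') dc bmul1r.
Qed.

Lemma wopTK (b bt : A1) : bunit b -> bunit bt ->
  cancel (wopT b bt) (wopS b bt).
Proof.
move=> ub ubt a; have [_ h] := binvP (bunitM ubt ub).
by rewrite /wopS /wopT /opT !lactM -?bmulA h lact1 autK.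
Qed.

Lemma wopSK (b bt : A1) : bunit b -> bunit bt ->
  cancel (wopS b bt) (wopT b bt).
Proof.
move=> ub ubt a; have [h _] := binvP (bunitM ubt ub).
by rewrite /wopS /wopT /opT autVK !lactM ?bmulA h lact1.
Qed.

End Operators.

(* Main.v *)
(* If [x] is periodic, then along multiples of its period the weighted orbits
   of [x] are constant, and the series of (2) are those of strong aperiodicity.
   Conversely, [T (a a') = T a * Phi a'], so the series of (2) are the sums of
   the forward and backward orbits of [x p_i] under [W := (bt T)^(d k)].
   Adding [x p_i] itself gives a sum over the whole two-sided orbit, which [W]
   merely shifts, hence fixes; these periodic elements tend to [x p_i] as
   [k] grows, and the elements [x p_i] are dense. *)

Require Import Defs.
From HB Require Import structures.
From mathcomp Require Import all_boot all_order all_algebra.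
From mathcomp Require Import all_classical all_reals all_analysis.

Set Implicit Arguments.
Unset Strict Implicit.
Unset Printing Implicit Defensive.

Import Order.TTheory GRing.Theory Num.Theory.
Import numFieldNormedType.Exports.

Local Open Scope classical_set_scope.
Local Open Scope ring_scope.

Lemma iter_cancel (T : Type) (f g : T -> T) (n : nat) :
  cancel f g -> cancel (iter n f) (iter n g).
Proof. by move=> fK; elim: n => // n IH x; rewrite iterSr /= fK IH. Qed.

Section NormedModules.
Context {K : numFieldType}.

(** Additivity turns the bound into a Lipschitz estimate. Only additivity is asked of [f] because
    [lact J c] and [aut Phi] are carried as bare functions. *)
Lemma additive_bounded_continuous (V W : normedModType K) (f : V -> W) (M : K) :
  {morph f : x y / x + y} -> 0 <= M -> (forall x, `|f x| <= M * `|x|) ->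
  continuous f.
Proof.
move=> fD M0 fM x; apply/cvgrPdist_lt => e e0.
have fB y z : f y - f z = f (y - z) by apply: (addIr (f z)); rewrite subrK -fD subrK.
(* [M] may be 0, so the radius is [e / (M + 1)]. *)
have M1 : 0 < M + 1 by rewrite ltr_wpDl.
near=> y; rewrite fB; apply: le_lt_trans (fM _) _.
apply: (@le_lt_trans _ _ ((M + 1) * `|x - y|)).
  by rewrite ler_wpM2r // lerDl.
rewrite mulrC -ltr_pdivlMr //; near: y.
by apply: cvgr_dist_lt; [exact: cvg_id | rewrite divr_gt0].
Unshelve. all: by end_near. Qed.

Lemma continuous_iter (T : topologicalType) (f : T -> T) (n : nat) :
  continuous f -> continuous (iter n f).
Proof.
move=> fc; elim: n => [|n IH] x; first exact: cvg_id.
by apply: (@continuous_comp _ _ _ (iter n f) f x); [exact: IH | exact: fc].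
Qed.

Lemma iterD_morph (V : zmodType) (f : V -> V) (n : nat) :
  {morph f : x y / x + y} -> {morph iter n f : x y / x + y}.
Proof. by move=> fD; elim: n => // n IH x y /=; rewrite IH fD. Qed.

(** On partial sums, [F] moves each forward term to the next one and cancels one [G] in each
    backward term. Continuity of [F] carries both shift relations to the limits. *)
Lemma bilateral_orbit_sum_fixed (V : completeNormedModType K)
    (F G : V -> V) (u : V) :
  {morph F : x y / x + y} -> continuous F -> cancel G F ->
  series1_cvg (fun n => iter n F u) -> series1_cvg (fun n => iter n G u) ->
  let y := u + series1_sum (fun n => iter n F u)
             + series1_sum (fun n => iter n G u) in
  F y = y.
Proof.
move=> FD Fc GK cF cG y.
have F0 : F 0 = 0 by apply: (addrI (F 0)); rewrite -FD !addr0.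
have seriesS f N : series1 f N.+1 = series1 f N + f N.+1 :> V.
  by rewrite /series1 big_nat_recr.
have series0 f : series1 f 0 = 0 :> V by rewrite /series1 big_geq.
have shiftF N : F (series1 (fun n => iter n F u) N) + F u
    = series1 (fun n => iter n F u) N.+1.
  elim: N => [|N IH]; first by rewrite seriesS !series0 F0.
  by rewrite seriesS FD addrAC IH [RHS]seriesS.
(* The first backward term [G u] is sent to [u], so [N.+1] terms become [u] plus the first [N]
   terms. *)
have shiftG N : F (series1 (fun n => iter n G u) N.+1)
    = u + series1 (fun n => iter n G u) N.
  elim: N => [|N IH]; first by rewrite seriesS !series0 FD F0 addr0 add0r GK.
  by rewrite seriesS FD IH [in RHS]seriesS addrA iterS GK.
pose sF := series1 (fun n => iter n F u); pose sG := series1 (fun n => iter n G u).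
have sumF : F (limn sF) + F u = limn sF.
  have cFl : sF N.+1 @[N --> \oo] --> F (limn sF) + F u.
    rewrite -(eq_cvg _ _ shiftF); apply: cvgD; last exact: cvg_cst.
    by apply: continuous_cvg; [exact: Fc | exact: cF].
  have cFr : sF N.+1 @[N --> \oo] --> limn sF by rewrite (cvg_shiftS sF).
  exact: (cvg_unique (@norm_hausdorff _ V) cFl cFr).
have sumG : F (limn sG) = u + limn sG.
  have cGl : F (sG N.+1) @[N --> \oo] --> F (limn sG).
    by apply: continuous_cvg; [exact: Fc | rewrite (cvg_shiftS sG)].
  have cGr : F (sG N.+1) @[N --> \oo] --> u + limn sG.
    by rewrite (eq_cvg _ _ shiftG); apply: cvgD; [exact: cvg_cst | exact: cG].
  exact: (cvg_unique (@norm_hausdorff _ V) cGl cGr).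
(* [F u] supplies the first term missing from the shifted forward sum, and the shifted backward sum
   gives [u] back. *)
by rewrite /y !FD (addrC (F u)) sumF sumG addrCA addrA.
Qed.

End NormedModules.

Section WeightedOperators.
Context {K : numFieldType} {A : banachAlgType K} {A1 : unitalBanachAlgType K}.
Context {J : leftIdeal A A1} (Phi : idealAut J).

(** [lact] and [aut] are specified only through the embedding [J], so their identities are checked
    in [A1] and pulled back by injectivity. *)
Lemma lactD (c : A1) : {morph lact J c : x y / x + y}.
Proof.
by move=> x y; apply: (@lemb_inj _ _ _ J); rewrite raddfD /= !lactE raddfD bmulDr.
Qed.

Lemma lact_bmul (c : A1) (x y : A) : lact J c (bmul x y) = bmul (lact J c x) y.
Proof. by apply: (@lemb_inj _ _ _ J); rewrite lactE !lembM lactE bmulA. Qed.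

Lemma autD : {morph aut Phi : x y / x + y}.
Proof.
by move=> x y; apply: (@lemb_inj _ _ _ J); rewrite autE !raddfD /= !autE.
Qed.

Lemma aut_bmul : {morph aut Phi : x y / bmul x y}.
Proof.
by move=> x y; apply: (@lemb_inj _ _ _ J); rewrite autE !lembM aut1M !autE.
Qed.

Lemma autV_bmul : {morph autV Phi : x y / bmul x y}.
Proof.
by move=> x y; apply: (can_inj (autK Phi)); rewrite aut_bmul !(autVK Phi).
Qed.

Variables b bt : A1.

Lemma wopTD : {morph wopT Phi b bt : x y / x + y}.
Proof. by move=> x y; rewrite /wopT /opT autD !lactD. Qed.

(** The weights multiply from the left, so the first factor absorbs them and the second one sees
    only [aut Phi]. *)
Lemma wopT_bmul (x y : A) :
  wopT Phi b bt (bmul x y) = bmul (wopT Phi b bt x) (aut Phi y).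
Proof. by rewrite /wopT /opT aut_bmul !lact_bmul. Qed.

Lemma wopS_bmul (x y : A) :
  wopS Phi b bt (bmul x y) = bmul (wopS Phi b bt x) (autV Phi y).
Proof. by rewrite /wopS lact_bmul autV_bmul. Qed.

Lemma iter_wopT_bmul (n : nat) (x y : A) :
  iter n (wopT Phi b bt) (bmul x y)
  = bmul (iter n (wopT Phi b bt) x) (iter n (aut Phi) y).
Proof. by elim: n => //= n ->; rewrite wopT_bmul. Qed.

Lemma iter_wopS_bmul (n : nat) (x y : A) :
  iter n (wopS Phi b bt) (bmul x y)
  = bmul (iter n (wopS Phi b bt) x) (iter n (autV Phi) y).
Proof. by elim: n => //= n ->; rewrite wopS_bmul. Qed.

Lemma wopT_continuous (C : K) :
  0 < C -> (forall (a : A) (c : A1), `|lact J c a| <= C * `|c| * `|a|) ->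
  continuous (wopT Phi b bt).
Proof.
move=> C0 lact_norm.
(* One factor for each of the two left multiplications; [aut Phi] is isometric. *)
apply: (@additive_bounded_continuous _ _ _ _ (C * `|bt| * (C * `|b|))).
- exact: wopTD.
- by rewrite !mulr_ge0 // ltW.
- move=> x; rewrite -mulrA; apply: le_trans (lact_norm _ _) _.
  rewrite -(aut_norm Phi x) ler_wpM2l ?lact_norm //.
  by rewrite mulr_ge0 // ltW.
Qed.

End WeightedOperators.

Theorem theorem2p1 (K : numFieldType)
    (A : banachAlgType K) (A1 : unitalBanachAlgType K) (J : leftIdeal A A1)
    (nonunitA : nonunital A)
    (C : K) (C_gt0 : 0 < C)
    (lact_norm : forall (a : A) (c : A1), `|lact J c a| <= C * `|c| * `|a|)
    (I : Type) (p : I -> A)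
    (p_approx : right_approximation p)
    (p_contr : forall (a : A) (i : I), `|bmul a (p i)| <= `|a|)
    (Phi : idealAut J) (Phi_aper : strongly_aperiodic Phi p)
    (b : A1) (b_unit : bunit b)
    (beta : set A1) (beta_unit : beta `<=` @bunit K A1) :
  dense (weighted_periodic Phi b beta)
  <->
  exists2 D : set A, dense D &
    forall (x : A) (i : I), D x ->
    exists2 bt : A1, beta bt & exists2 d : nat, (0 < d)%N &
      [/\ forall k : nat, (0 < k)%N ->
            series1_cvg (fun n => bmul (iter (n * d * k) (wopT Phi b bt) x)
                                       (iter (n * d * k) (aut Phi) (p i))) /\
            series1_cvg (fun n => bmul (iter (n * d * k) (wopS Phi b bt) x)
                                       (iter (n * d * k) (autV Phi) (p i))),
          series1_sum (fun n => bmul (iter (n * d * k) (wopT Phi b bt) x)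
                                     (iter (n * d * k) (aut Phi) (p i)))
            @[k --> \oo] --> (0 : A)
        & series1_sum (fun n => bmul (iter (n * d * k) (wopS Phi b bt) x)
                                     (iter (n * d * k) (autV Phi) (p i)))
            @[k --> \oo] --> (0 : A)].
Proof.
split=> [per_dense | [D D_dense D_series]].
  exists (weighted_periodic Phi b beta) => // x i [bt beta_bt [d d0 x_per]].
  exists bt => //; have [N N0 aper] := Phi_aper i.
  (* A multiple of [d] keeps the orbits of [x] constant, and being at least [N] gives access to
     strong aperiodicity. *)
  exists (d * N)%N; first by rewrite muln_gt0 d0.
  have [ub ubt] := (b_unit, beta_unit _ beta_bt).
  have x_fix : iter d (wopT Phi b bt) x = x by rewrite -[d]mul1n x_per.
  have x_fixV : iter d (wopS Phi b bt) x = x.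
    by rewrite -{1}x_fix (iter_cancel _ (wopTK Phi ub ubt)).
  have orbT m : iter (m * d) (wopT Phi b bt) x = x by rewrite iterM iter_fix.
  have orbS m : iter (m * d) (wopS Phi b bt) x = x by rewrite iterM iter_fix.
  have seriesT k :
      (fun n => bmul (iter (n * (d * N) * k) (wopT Phi b bt) x)
                     (iter (n * (d * N) * k) (aut Phi) (p i)))
      = (fun n => bmul x (iter (n * (d * N) * k) (aut Phi) (p i))).
    by apply/funext => n; rewrite {1}mulnAC (mulnC d) mulnA orbT.
  have seriesS k :
      (fun n => bmul (iter (n * (d * N) * k) (wopS Phi b bt) x)
                     (iter (n * (d * N) * k) (autV Phi) (p i)))
      = (fun n => bmul x (iter (n * (d * N) * k) (autV Phi) (p i))).
    by apply/funext => n; rewrite {1}mulnAC (mulnC d) mulnA orbS.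
  have [_ _ limT limS] := aper x (d * N)%N (leq_pmull N d0).
  split.
  - move=> k k0; rewrite seriesT seriesS.
    (* Strong aperiodicity at [l = d * N] gives the limits in [k]; convergence for a fixed [k] is
       its instance at [l = d * N * k]. *)
    have Nle : (N <= d * N * k)%N by rewrite mulnAC leq_pmull // muln_gt0 d0.
    have [cT cS _ _] := aper x _ Nle.
    under eq_fun do rewrite -mulnA.
    by under [X in _ /\ series1_cvg X]eq_fun do rewrite -mulnA.
  - by under eq_cvg do rewrite seriesT.
  - by under eq_cvg do rewrite seriesS.
move=> O O_neq0 O_open.
have [x [Ox Dx]] := D_dense O O_neq0 O_open.
(* The same open set serves twice: first for [x], then for [bmul x (p i)], the point that the
   periodic elements will approach. *)
have [i Oxp] := p_approx O O_neq0 O_open x Ox.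
have [bt beta_bt [d d0 [series_cvg limT limS]]] := D_series x i Dx.
have [ub ubt] := (b_unit, beta_unit _ beta_bt).
set sT := fun k => series1_sum _ in limT.
set sS := fun k => series1_sum _ in limS.
pose y k := bmul x (p i) + sT k + sS k.
have y_lim : y k @[k --> \oo] --> bmul x (p i).
  rewrite -[X in _ --> X]addr0 -[X in _ --> X + 0]addr0.
  by apply: cvgD => //; apply: cvgD => //; exact: cvg_cst.
have y_fix k : (0 < k)%N -> iter (d * k) (wopT Phi b bt) (y k) = y k.
  move=> k0; have [cT cS] := series_cvg k k0.
  have orbT : (fun n => bmul (iter (n * d * k) (wopT Phi b bt) x)
                             (iter (n * d * k) (aut Phi) (p i)))
    = fun n => iter n (iter (d * k) (wopT Phi b bt)) (bmul x (p i)).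
    by apply/funext => n; rewrite -iterM mulnA iter_wopT_bmul.
  have orbS : (fun n => bmul (iter (n * d * k) (wopS Phi b bt) x)
                             (iter (n * d * k) (autV Phi) (p i)))
    = fun n => iter n (iter (d * k) (wopS Phi b bt)) (bmul x (p i)).
    by apply/funext => n; rewrite -iterM mulnA iter_wopS_bmul.
  rewrite /y /sT /sS orbT orbS; rewrite orbT in cT; rewrite orbS in cS.
  apply: bilateral_orbit_sum_fixed cT cS.
  - exact: iterD_morph (wopTD Phi b bt).
  - by apply: continuous_iter; exact: wopT_continuous C_gt0 lact_norm.
  - exact: iter_cancel (wopSK Phi ub ubt).
have Oy : \forall k \near \oo, O (y k).
  by apply: y_lim; exact: open_nbhs_nbhs.
have [k0 _ Oyk] := Oy.
(* The successor avoids [k = 0], where the series need not converge, so that [y 0] may be a default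
   value, and where [d * k] is no admissible period. *)
exists (y k0.+1); split; first exact: Oyk (leqnSn k0).
exists bt => //; exists (d * k0.+1)%N; first by rewrite muln_gt0 d0.
by move=> n _; rewrite iterM iter_fix // y_fix.
Qed.
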